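(* Let $0\leq m_r\leq d_r$, $0\leq m_f\leq d_f$ satisfy $d_r\geq d_f-m_f$, $d_f\geq d_r-m_r$, and let $0\leq m_r'\leq d_r'$, $0\leq m_f'\leq d_f'$ satisfy $d_r'\geq d_f'-m_f'$, $d_f'\geq d_r'-m_r'$. The following are equivalent: (i) for every $u\in S$, $Sol_{BDC}^{m_r,d_r,m_f,d_f}(u)\subset Sol_{BDC}^{m_r',d_r',m_f',d_f'}(u)$; (ii) $d_r'-m_r'\leq d_r-m_r\leq d_f\leq d_f'$ and $d_f'-m_f'\leq d_f-m_f\leq d_r\leq d_r'$.
   Context: $\mathbf{B}=\{0,1\}$ with Boolean operations, ordered by $0<1$. $S$ is the set of signals: functions $x:\mathbb{R}\to\mathbf{B}$ for which there is a strictly increasing unbounded sequence $t_0<t_1<t_2<\dots$ of reals such that $x$ is constant on $(-\infty,t_0)$ and on each $[t_k,t_{k+1})$. For a bounded interval $I$ and $u\in S$, $\bigcap_{\xi\in I}u(\xi)$ equals $1$ iff $u(\xi)=1$ for all $\xi\in I$, and $\bigcup_{\xi\in I}u(\xi)$ equals $1$ iff $u(\xi)=1$ for some $\xi\in I$. For $0\leq m_r\leq d_r$, $0\leq m_f\leq d_f$ and $u\in S$, $Sol_{BDC}^{m_r,d_r,m_f,d_f}(u)$ is the set of $x\in S$ such that for all $t\in\mathbb{R}$: $\bigcap_{\xi\in[t-d_r,t-d_r+m_r]}u(\xi)\leq x(t)\leq\bigcup_{\xi\in[t-d_f,t-d_f+m_f]}u(\xi)$. *)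

(* Defs.v *)
From HB Require Import structures.
From mathcomp Require Import all_boot all_order all_algebra.
From mathcomp Require Import all_classical all_reals.
Set Implicit Arguments.
Unset Strict Implicit.
Unset Printing Implicit Defensive.
Import Order.TTheory GRing.Theory Num.Theory.
Local Open Scope classical_set_scope.
Local Open Scope ring_scope.

Definition signal (R : realType) : set (R -> bool) :=
  [set x | exists t : nat -> R,
    [/\ forall k, t k < t k.+1,
        forall M : R, exists k, M < t k,
        forall s s', s < t 0%N -> s' < t 0%N -> x s = x s' &
        forall k s s', t k <= s < t k.+1 -> t k <= s' < t k.+1 -> x s = x s'] ].

Definition bcap (R : realType) (I : set R) (u : R -> bool) : bool :=
  `[< forall xi, I xi -> u xi = true >].

Definition bcup (R : realType) (I : set R) (u : R -> bool) : bool :=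
  `[< exists xi, I xi /\ u xi = true >].

(* The order on bool is the library's one, with false < true. *)
Definition Sol_BDC (R : realType) (mr dr mf df : R) (u : R -> bool) :
    set (R -> bool) :=
  [set x | signal x /\
    forall t : R,
      (bcap `[t - dr, t - dr + mr] u <= x t)%O /\
      (x t <= bcup `[t - df, t - df + mf] u)%O].

(* Main.v *)
Require Import Defs.
From mathcomp Require Import all_boot all_order all_algebra.
From mathcomp Require Import all_classical all_reals.
From mathcomp Require Import lra.
Import Order.TTheory GRing.Theory Num.Theory.
Local Open Scope classical_set_scope.
Local Open Scope ring_scope.

(** Condition (ii) says that the windows [[-dr, -dr + mr]] and [[-df, -df + mf]]
    are contained in their primed counterparts, so (ii) implies (i) by
    monotonicity of intersections and unions.  Conversely, let [u] be the
    indicator of [[-dr', -dr' + mr' + e)] with [e > 0].  The least solution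
    [t |-> bcap `[t - dr, t - dr + mr] u] is again the indicator of a half-open
    interval, hence a signal, and at time [0] the primed lower bound forces it
    to be [1]; this yields the containment of the rising windows up to [e].
    Complementing [u] and [x] exchanges the two windows and gives the other
    containment. *)

Definition ico_indic {R : realType} (a b : R) : R -> bool := fun s => a <= s < b.

Lemma signal_ico_indic (R : realType) (a b : R) : signal (ico_indic a b).
Proof.
(* The breakpoints are [a + h * k]. For [a < b] the step [b - a] makes [[a, b)] exactly the first
   piece; otherwise the indicator is identically false and any positive step works. *)
pose h := if a < b then b - a else 1.
have h0 : 0 < h by rewrite /h; case: ifP => // ab; rewrite subr_gt0.
exists (fun k => a + h * k%:R); split.
- by move=> k; rewrite ltrD2l ltr_pM2l // ltr_nat.
- move=> M; exists (Num.bound `|(M - a) / h|).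
  rewrite -ltrBlDl mulrC -ltr_pdivrMr //.
  exact: le_lt_trans (ler_norm _) (archi_boundP (normr_ge0 _)).
- move=> s s'; rewrite mulr0 addr0 /ico_indic => sa s'a.
  by rewrite !leNgt sa s'a.
have step k s : a + h * k%:R <= s < a + h * k.+1%:R ->
    ico_indic a b s = (k == 0%N) && (a < b).
  case/andP => ks sk; rewrite /ico_indic.
  have as_ : a <= s.
    by apply: le_trans ks; rewrite lerDl mulr_ge0 // ltW.
  rewrite as_ /=; move: ks sk h0; rewrite /h; case: (ltP a b) => ab ks sk h0.
    rewrite andbT; case: k ks sk => [|k] ks sk /=.
      by move: sk; rewrite mulr1 addrC subrK.
    apply/negbTE; rewrite -leNgt; apply: le_trans ks.
    rewrite -lerBlDl ler_peMr ?ler1n //; exact: ltW.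
  by rewrite andbF; apply/negbTE; rewrite -leNgt (le_trans ab).
by move=> k s s' /step -> /step ->.
Qed.

Lemma signalN (R : realType) (x : R -> bool) :
  signal x -> signal (fun s => ~~ x s).
Proof.
case=> t [tS tM x0 xS]; exists t; split=> //.
- by move=> s s' ? ?; rewrite (x0 s s').
- by move=> k s s' ks ks'; rewrite (xS k s s').
Qed.

Lemma le_boolE (b c : bool) : (b <= c)%O = (b ==> c).
Proof. by case: b; case: c. Qed.

Lemma bcap_subset (R : realType) (I J : set R) (u : R -> bool) :
  I `<=` J -> (bcap J u <= bcap I u)%O.
Proof.
move=> IJ; rewrite le_boolE; apply/implyP => /asboolP uJ.
by apply/asboolP => s /IJ /uJ.
Qed.

Lemma bcup_subset (R : realType) (I J : set R) (u : R -> bool) :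
  I `<=` J -> (bcup I u <= bcup J u)%O.
Proof.
move=> IJ; rewrite le_boolE; apply/implyP => /asboolP[s [/IJ Js us]].
by apply/asboolP; exists s.
Qed.

Lemma bcupN (R : realType) (I : set R) (u : R -> bool) :
  bcup I (fun s => ~~ u s) = ~~ bcap I u.
Proof.
apply/idP/idP.
  move=> /asboolP[s [Is us]]; apply/negP => /asboolP/(_ s Is) us'.
  by rewrite us' in us.
apply: contraR => /asboolPn uI; apply/asboolP => s Is.
by apply: contrapT => /negP us; apply: uI; exists s.
Qed.

Lemma bcapN (R : realType) (I : set R) (u : R -> bool) :
  bcap I (fun s => ~~ u s) = ~~ bcup I u.
Proof.
by rewrite -[LHS]negbK -bcupN; congr (~~ bcup I _); apply/funext => s; rewrite negbK.
Qed.

(** By convexity only the two endpoints matter, and [p <= q] puts both in the window. *)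
Lemma bcap_ico_indic (R : realType) (a b p q : R) :
  p <= q -> bcap `[p, q] (ico_indic a b) = (a <= p) && (q < b).
Proof.
move=> pq; apply/asboolP/andP => [H|[ap qb] s].
  have /andP[ap _] : ico_indic a b p by apply: H; rewrite /= in_itv /= lexx.
  have /andP[_ qb] : ico_indic a b q by apply: H; rewrite /= in_itv /= lexx pq.
  by [].
rewrite /= in_itv /= => /andP[ps sq].
by apply/andP; rewrite (le_trans ap ps) (le_lt_trans sq qb).
Qed.

Lemma bcap_le_bcup (R : realType) (I J : set R) (u : R -> bool) (s : R) :
  I s -> J s -> (bcap I u <= bcup J u)%O.
Proof.
move=> Is Js; rewrite le_boolE; apply/implyP => /asboolP uI.
by apply/asboolP; exists s; split=> //; exact: uI.
Qed.

(** By De Morgan, complementing turns the lower bound into the upper one and conversely. *)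
Lemma Sol_BDCN (R : realType) (mr dr mf df : R) (u x : R -> bool) :
  Sol_BDC mr dr mf df u x ->
  Sol_BDC mf df mr dr (fun s => ~~ u s) (fun s => ~~ x s).
Proof.
case=> sx H; split; first exact: signalN.
by move=> t; have [] := H t; rewrite bcapN bcupN !le_boolE !implybNN.
Qed.

Lemma Sol_BDC_subsetN (R : realType) (mr dr mf df mr' dr' mf' df' : R) :
  (forall u : R -> bool, signal u ->
     Sol_BDC mr dr mf df u `<=` Sol_BDC mr' dr' mf' df' u) ->
  forall u : R -> bool, signal u ->
     Sol_BDC mf df mr dr u `<=` Sol_BDC mf' df' mr' dr' u.
Proof.
move=> H u su x /Sol_BDCN /(H _ (signalN _ _ su)) /Sol_BDCN.
have NN (v : R -> bool) : (fun s => ~~ ~~ v s) = v.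
  by apply/funext => s; rewrite negbK.
by rewrite !NN.
Qed.

Lemma Sol_BDC_subset_rise_window (R : realType)
    (mr dr mf df mr' dr' mf' df' : R) :
  0 <= mr -> 0 <= mf -> 0 <= mr' -> df - mf <= dr -> dr - mr <= df ->
  (forall u : R -> bool, signal u ->
     Sol_BDC mr dr mf df u `<=` Sol_BDC mr' dr' mf' df' u) ->
  dr' - mr' <= dr - mr /\ dr <= dr'.
Proof.
move=> mr0 mf0 mr'0 hrf hfr H.
(* The slack [e] lets a half-open support contain the closed window [[-dr', -dr' + mr']]; it is
   removed at the end since [e] is arbitrary. *)
have key (e : R) : 0 < e -> dr <= dr' /\ mr - dr < mr' - dr' + e.
  move=> e0; pose u := ico_indic (- dr') (mr' - dr' + e).
  pose x t := bcap `[t - dr, t - dr + mr] u.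
  have xE t : x t = ico_indic (dr - dr') (mr' - dr' + e + dr - mr) t.
    rewrite /x bcap_ico_indic ?lerDl // /ico_indic.
    by congr (_ && _); apply/idP/idP; lra.
  have xSol : Sol_BDC mr dr mf df u x.
    split; first by rewrite (funext xE); exact: signal_ico_indic.
    move=> t; split=> //.
    (* The larger left end lies in both windows: [hrf] and [hfr] say that neither window ends before
       the other begins. *)
    apply: (@bcap_le_bcup _ _ _ _ (Num.max (t - dr) (t - df))).
      by rewrite /= in_itv /= le_max ge_max lexx /=; apply/andP; split; lra.
    by rewrite /= in_itv /= le_max ge_max lexx orbT /=; apply/andP; split; lra.
  have [_ /(_ 0) [+ _]] := H u (signal_ico_indic _ _ _) x xSol.
  have -> : bcap `[0 - dr', 0 - dr' + mr'] u = true.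
    by rewrite bcap_ico_indic ?lerDl //; apply/andP; split; lra.
  (* The forced value [x 0 = true] places 0 in the support of [x], whose two ends give the two
     inequalities. *)
  by rewrite le_boolE /= xE => /andP[? ?]; split; lra.
split; last by have [] := key 1 ltr01.
suff : mr - dr <= mr' - dr' by lra.
by apply/ler_addgt0Pr => e /key[_ /ltW].
Qed.

Lemma window_subset (R : realType) (m d m' d' t : R) :
  d' - m' <= d - m -> d <= d' ->
  `[t - d, t - d + m] `<=` `[t - d', t - d' + m'].
Proof.
move=> h1 h2 s; rewrite /= !in_itv /= => /andP[h3 h4].
by apply/andP; split; lra.
Qed.

Theorem theorem1p4 (R : realType) (mr dr mf df mr' dr' mf' df' : R)
  (hr : 0 <= mr <= dr) (hf : 0 <= mf <= df)
  (hrf : dr >= df - mf) (hfr : df >= dr - mr)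
  (hr' : 0 <= mr' <= dr') (hf' : 0 <= mf' <= df')
  (hrf' : dr' >= df' - mf') (hfr' : df' >= dr' - mr') :
  (forall u : R -> bool, signal u ->
     Sol_BDC mr dr mf df u `<=` Sol_BDC mr' dr' mf' df' u)
  <->
  ((dr' - mr' <= dr - mr /\ dr - mr <= df /\ df <= df') /\
   (df' - mf' <= df - mf /\ df - mf <= dr /\ dr <= dr')).
Proof.
case/andP: hr hf hr' hf' => mr0 _ /andP[mf0 _] /andP[mr'0 _] /andP[mf'0 _].
split=> [H|[[h1 [_ h2]] [h3 [_ h4]]] u su x [sx H]].
  have [? ?] := Sol_BDC_subset_rise_window _ _ _ _ _ _ _ _ _ mr0 mf0 mr'0 hrf hfr H.
  (* Complementation swaps the rising and falling parameters, so the same lemma bounds the falling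
     window. *)
  have [? ?] :=
    Sol_BDC_subset_rise_window _ _ _ _ _ _ _ _ _ mf0 mr0 mf'0 hfr hrf
      (Sol_BDC_subsetN _ _ _ _ _ _ _ _ _ H).
  by [].
(* Passing to the larger primed windows lowers the intersection and raises the union. *)
split=> // t; have [lo up] := H t; split.
  exact: le_trans (bcap_subset _ _ _ _ (window_subset _ _ _ _ _ _ h1 h4)) lo.
exact: le_trans up (bcup_subset _ _ _ _ (window_subset _ _ _ _ _ _ h3 h2)).
Qed.
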